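(* Let $a\in\mathbb{N}$ and $b,m,n\in\mathbb{N}_0$ be such that $b\leq a$ and $m\leq n$. Then $A(b,a;n,m)\in\mathbb{N}_0[q]$ if and only if $A(b,a;n+la,\,m+ka)\in\mathbb{N}_0[q]$ for all integers $k,l$ such that $0\leq m+ka\leq n+la$.
   Context: $\mathbb{N}$ is the set of positive integers and $\mathbb{N}_0=\mathbb{N}\cup\{0\}$. $\mathbb{N}_0[q]$ is the set of polynomials in the indeterminate $q$ with nonnegative integer coefficients. Let $(q;q)_0=1$ and $(q;q)_n=\prod_{i=1}^{n}(1-q^i)$. For $m,n\in\mathbb{N}_0$ the $q$-binomial coefficient is $\left[{n\atop m}\right]=\frac{(q;q)_n}{(q;q)_m(q;q)_{n-m}}$ if $n\geq m\geq 0$, and $0$ otherwise. For $a\in\mathbb{N}$ and $b,m,n\in\mathbb{N}_0$ define the rational function of $q$ $$A(b,a;n,m)=\frac{1-q^b}{1-q^a}\left[{n\atop m}\right].$$ The statement $A(b,a;n,m)\in\mathbb{N}_0[q]$ means that this rational function is a polynomial in $q$ with nonnegative integer coefficients. *)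

(* Defs.v *)
From mathcomp Require Import all_boot all_order all_algebra.

Set Implicit Arguments.
Unset Strict Implicit.
Unset Printing Implicit Defensive.

Import GRing.Theory.
Local Open Scope ring_scope.

(* Q(q), as the fraction field of Z[q]. *)
Definition ratfun : fieldType := {fraction {poly int}}.

Definition q : ratfun := tofrac 'X.

Definition qpoch (n : nat) : ratfun := \prod_(1 <= i < n.+1) (1 - q ^+ i).

Definition qbinom (n m : nat) : ratfun :=
  if (m <= n)%N then qpoch n / (qpoch m * qpoch (n - m)) else 0.

(* Division is total in ratfun, so A b 0 n m = 0; only a > 0 is meaningful. *)
Definition A (b a n m : nat) : ratfun :=
  (1 - q ^+ b) / (1 - q ^+ a) * qbinom n m.

Definition in_N0q (f : ratfun) : Prop :=
  exists2 p : {poly int}, p \is a polyOver Num.nneg & f = tofrac p.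

(* Main.v *)
Require Import Defs.
From mathcomp Require Import all_boot all_order all_algebra all_field perm.
From mathcomp Require Import zify ring.

(** The key point is that A(b,a;n,m) has nonnegative coefficients as soon as it
    is a polynomial; the theorem then follows because being a polynomial only
    depends on n and m modulo a.

    Nonnegativity. The q-binomial coefficient is a symmetric and unimodal
    polynomial, and when (1 - q^b) p / (1 - q^a) is a polynomial for such a p,
    its coefficients are nonnegative (unimodal_quotient_ge0, an elementary
    induction on coefficients from both ends). Unimodality is the deep
    ingredient, Sylvester's theorem. It is proved with the representation of
    sl_2 on the m-th exterior power of its irreducible representation of
    dimension n: the basis vectors are the bit vectors of length n with m ones,
    the sum of the positions of the ones is the exponent of q, the raising
    operator shifts a one to the next position, and its commutator with the
    lowering operator is a negative scalar below the middle height
    (raise_lower_comm). Hence raising is injective there (raise_inj), which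
    bounds the cardinality of each level by that of the next one
    (leq_card_bit_level).

    Periodicity. The polynomial 1 - q^a has simple roots, the a-th roots of
    unity. At a root of unity of order d, the polynomial (q;q)_n vanishes to
    order n/d rounded down (mup_poch), so the q-binomial coefficient vanishes
    there exactly when adding m and n - m modulo d produces a carry
    (root_gauss). This condition is unchanged when n and m are shifted by
    multiples of a, since d divides a. *)

Set Implicit Arguments.
Unset Strict Implicit.

Import Order.TTheory GRing.Theory Num.Theory.
Local Open Scope ring_scope.

(** * A raising operator on bit vectors *)

(** The sl_2 argument, without an inner product: if X v = 0 then
    X (Y^(j+1) v) = (h_0 + ... + h_j) Y^j v, and these scalars are
    negative. Since Y is nilpotent on v, this descends from Y^N v = 0 to v = 0. *)
Lemma raising_inj (K : numFieldType) (V : lmodType K) (X Y : V -> V)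
    (h : nat -> K) (v : V) (N : nat) :
    X 0 = 0 -> (forall c u, Y (c *: u) = c *: Y u) ->
    (forall j, X (Y (iter j Y v)) = Y (X (iter j Y v)) + h j *: iter j Y v) ->
    (forall j, h j < 0) -> iter N Y v = 0 -> X v = 0 -> v = 0.
Proof.
move=> X0 YZ comm h_lt0 YN0 Xv0.
have [c c_lt0 XYc] : exists2 c : nat -> K, forall j, c j < 0 &
    forall j, X (iter j.+1 Y v) = c j *: iter j Y v.
  exists (fun j => \sum_(i < j.+1) h i) => [j|].
    rewrite big_ord_recr /= -[X in _ < X]addr0; apply: ler_ltD => //.
    by apply: sumr_le0 => i _; apply/ltW.
  elim=> [|j IHj].
    by rewrite iterS comm /= Xv0 -[in Y 0](scale0r 0) YZ scale0r add0r big_ord1.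
  by rewrite iterS comm IHj YZ -scalerDl [in RHS]big_ord_recr.
elim: N YN0 => [|N IHN] // YN0.
apply/IHN/eqP; move: (XYc N); rewrite YN0 X0 => /esym/eqP.
by rewrite scaler_eq0 lt_eqF.
Qed.

(** A linear map given by the kernel M that is injective on functions supported
    on A, already when its values are only tested on B, has a row-free
    #|A| x #|B| matrix. *)
Lemma leq_card_inj_kernel (K : fieldType) (T : finType) (A B : {set T})
    (M : T -> T -> K) :
    (forall f : T -> K, (forall t, t \notin A -> f t = 0) ->
       (forall t, t \in B -> \sum_s f s * M s t = 0) -> forall t, f t = 0) ->
  (#|A| <= #|B|)%N.
Proof.
move=> inj.
pose N : 'M[K]_(#|A|, #|B|) := \matrix_(i, j) M (enum_val i) (enum_val j).
suff: row_free N by move/eqP <-; apply: rank_leq_col.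
apply: inj_row_free => v vN0.
pose f t := \sum_(i | enum_val i == t) v 0 i.
have f_enum i : f (enum_val i) = v 0 i.
  rewrite /f (big_pred1 i) // => j /=; apply/eqP/eqP => [|->//].
  exact: enum_val_inj.
have f_out t : t \notin A -> f t = 0.
  move=> tA; rewrite /f big_pred0 // => i.
  by apply: contraNF tA => /eqP <-; apply: enum_valP.
apply/rowP => i; rewrite mxE -f_enum; apply: inj => // t tB.
have /rowP/(_ (enum_rank_in tB t)) := vN0; rewrite !mxE => vNt; rewrite -[RHS]vNt.
rewrite (bigID (mem A)) /= [X in _ + X]big1 ?addr0; last first.
  by move=> s sA; rewrite f_out ?mul0r.
rewrite big_enum_val; apply: eq_bigr => j _.
by rewrite mxE f_enum enum_rankK_in.
Qed.

Definition bit_weight n (x : {ffun 'I_n -> bool}) : nat := (\sum_(k < n) x k)%N.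
Definition bit_height n (x : {ffun 'I_n -> bool}) : nat :=
  (\sum_(k < n) k * x k)%N.

Definition bit_level n m k : {set {ffun 'I_n -> bool}} :=
  [set x | (bit_weight x == m) && (bit_height x == k)].

Section Raising.

Variable n : nat.
Notation T := {ffun 'I_n.+1 -> bool}.
Notation V := {ffun T -> rat^o}.
Implicit Types (x : T) (i j : 'I_n) (f : V).

(** Site i : 'I_n stands for the pair of adjacent positions i, i+1 of a bit
   vector of length n+1. *)
Definition lo i : 'I_n.+1 := widen_ord (leqnSn n) i.
Definition hi i : 'I_n.+1 := lift ord0 i.

Lemma lo_neq_hi i : lo i != hi i.
Proof. by rewrite -val_eqE /= /bump; lia. Qed.

Definition flip i x : T := [ffun k => x (tperm (lo i) (hi i) k)].
Definition can_up i x := x (lo i) && ~~ x (hi i).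
Definition can_down i x := ~~ x (lo i) && x (hi i).

Lemma flip_lo i x : flip i x (lo i) = x (hi i).
Proof. by rewrite ffunE tpermL. Qed.
Lemma flip_hi i x : flip i x (hi i) = x (lo i).
Proof. by rewrite ffunE tpermR. Qed.
Lemma flip_other i x k : k != lo i -> k != hi i -> flip i x k = x k.
Proof. by move=> k1 k2; rewrite ffunE tpermD // eq_sym. Qed.

Lemma flipK i : involutive (flip i).
Proof. by move=> x; apply/ffunP => k; rewrite !ffunE tpermK. Qed.

Lemma can_up_flip i x : can_up i (flip i x) = can_down i x.
Proof. by rewrite /can_up flip_lo flip_hi andbC. Qed.
Lemma can_down_flip i x : can_down i (flip i x) = can_up i x.
Proof. by rewrite /can_down flip_lo flip_hi andbC. Qed.

Lemma weight_flip i x : bit_weight (flip i x) = bit_weight x.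
Proof.
rewrite /bit_weight [RHS](reindex_inj (@perm_inj _ (tperm (lo i) (hi i)))).
by apply: eq_bigr => k _; rewrite ffunE.
Qed.

Lemma height_flip_down i x :
  can_down i x -> bit_height x = (bit_height (flip i x)).+1.
Proof.
case/andP=> /negPf xl xh; rewrite /bit_height.
rewrite (bigD1 (lo i)) // (bigD1 (hi i)) 1?eq_sym ?lo_neq_hi //=.
rewrite [in RHS](bigD1 (lo i)) // [in RHS](bigD1 (hi i)) 1?eq_sym ?lo_neq_hi //=.
rewrite flip_lo flip_hi xl xh /bump /=.
rewrite [in RHS](eq_bigr (fun k : 'I_n.+1 => (k * x k)%N)); first by lia.
by move=> k /andP[k1 k2]; rewrite flip_other.
Qed.

Lemma height_flip_up i x :
  can_up i x -> bit_height (flip i x) = (bit_height x).+1.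
Proof. by rewrite -can_down_flip => /height_flip_down; rewrite flipK. Qed.

(** Moves at different sites commute: if the sites are disjoint this is clear,
    and if they share a position then neither order is possible, since the
    shared bit would have to be both 0 and 1. *)
Lemma flip_comm i j x : i != j ->
  (can_down i x && can_up j (flip i x) = can_up j x && can_down i (flip j x))
  /\ (can_down i x && can_up j (flip i x) ->
      flip j (flip i x) = flip i (flip j x)).
Proof.
move=> neq_ij; rewrite /can_up /can_down.
have [ji|ji] := eqVneq (val j) (val i).+1.
  have lj : lo j = hi i by apply: val_inj; rewrite /= /bump.
  by rewrite !lj flip_hi -lj flip_lo; case: (x (lo i)) (x (hi j)) => [] [];
     rewrite /= ?andbF.
have [ij|ij] := eqVneq (val i) (val j).+1.
  have lj : lo i = hi j by apply: val_inj; rewrite /= /bump.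
  by rewrite -!lj flip_lo lj flip_hi; case: (x (lo j)) (x (hi i)) => [] [];
     rewrite /= ?andbF.
have val_ij : val i != val j by [].
have D1 : lo i != lo j by rewrite -val_eqE.
have D2 : lo i != hi j by rewrite -val_eqE.
have D3 : hi i != lo j by rewrite -val_eqE /= /bump; move: ji; rewrite eq_sym.
have D4 : hi i != hi j by rewrite -val_eqE /= /bump.
have [D5 D6] : lo j != lo i /\ hi j != lo i by rewrite eq_sym D1 eq_sym D2.
have [D7 D8] : lo j != hi i /\ hi j != hi i by rewrite eq_sym D3 eq_sym D4.
split; first by rewrite !flip_other // andbC.
move=> _; apply/ffunP => k.
have [->|k1] := eqVneq k (lo i).
  by rewrite [LHS]flip_other // !flip_lo flip_other.
have [->|k2] := eqVneq k (hi i).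
  by rewrite [LHS]flip_other // !flip_hi flip_other.
rewrite [RHS]flip_other //.
have [->|k3] := eqVneq k (lo j).
  by rewrite !flip_lo flip_other.
have [->|k4] := eqVneq k (hi j).
  by rewrite !flip_hi flip_other.
by rewrite !flip_other.
Qed.

(** In the irreducible representation of sl_2 of dimension n+1, scaled so that
    the raising operator sends e_i to e_(i+1), the lowering operator sends
    e_(i+1) to (i+1)(n-i) e_i. The operators raise and
    lower below are its action on the exterior powers, where no sign occurs
    because only adjacent positions are exchanged. *)
Definition lower_coef i : rat := (i.+1 * (n - i))%:R.

Definition raise f : V := [ffun x => \sum_i (can_down i x)%:R * f (flip i x)].
Definition lower f : V :=
  [ffun x => \sum_i lower_coef i * (can_up i x)%:R * f (flip i x)].

(** Summation by parts: lower_coef extends by 0 to both ends, and its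
    successive differences are 2k - n. *)
Lemma lower_coef_abel x :
  \sum_i lower_coef i * ((x (hi i))%:R - (x (lo i))%:R)
    = (2 * bit_height x)%:R - (n * bit_weight x)%:R.
Proof.
pose up := (\sum_(k < n.+1) k * (n.+1 - k) * x k)%N.
pose down := (\sum_(k < n.+1) k.+1 * (n - k) * x k)%N.
have -> : \sum_i lower_coef i * ((x (hi i))%:R - (x (lo i))%:R)
    = up%:R - down%:R.
  rewrite /up /down big_ord_recl big_ord_recr /= subnn muln0 !mul0n addn0 add0n.
  rewrite !natr_sum -sumrB; apply: eq_bigr => i _.
  by rewrite mulrBr -!natrM /bump /= ?add1n ?subSS.
apply/eqP; rewrite subr_eq addrAC eq_sym subr_eq -!natrD; apply/eqP.
congr _%:R; rewrite /up /down /bit_height /bit_weight !big_distrr -!big_split.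
by apply: eq_bigr => k _ /=; have := ltn_ord k; case: (x k) => /=; nia.
Qed.

(** By flip_comm only the terms where both operators act at the same site
    survive in the commutator. The result is a scalar on vectors of fixed
    weight and height, negative below the middle height. *)
Lemma raise_lower_comm f x :
  raise (lower f) x = lower (raise f) x
    + ((2 * bit_height x)%:R - (n * bit_weight x)%:R) * f x.
Proof.
(* E1 and E2 are the contributions of moving at i and j in the two orders. *)
pose E1 i j : rat := lower_coef j *
  (can_down i x && can_up j (flip i x))%:R * f (flip j (flip i x)).
pose E2 i j : rat := lower_coef j *
  (can_up j x && can_down i (flip j x))%:R * f (flip i (flip j x)).
have -> : raise (lower f) x = \sum_i \sum_j E1 i j.
  rewrite ffunE; apply: eq_bigr => i _; rewrite ffunE mulr_sumr.
  by apply: eq_bigr => j _; rewrite /E1 -mulnb natrM; ring.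
have -> : lower (raise f) x = \sum_i \sum_j E2 i j.
  rewrite ffunE exchange_big; apply: eq_bigr => j _; rewrite ffunE mulr_sumr.
  by apply: eq_bigr => i _; rewrite /E2 -mulnb natrM; ring.
rewrite -lower_coef_abel mulr_suml -big_split; apply: eq_bigr => i _ /=.
rewrite (bigD1 i) // [in RHS](bigD1 i) //=.
have -> : \sum_(j | j != i) E1 i j = \sum_(j | j != i) E2 i j.
  apply: eq_bigr => j; rewrite eq_sym => /flip_comm-/(_ x)[e1 e2].
  rewrite /E1 /E2 -e1; case: (boolP (_ && _)) => [/e2 -> //|_].
  by rewrite !mulr0 !mul0r.
rewrite /E1 /E2 can_up_flip can_down_flip !andbb flipK /can_down /can_up.
by case: (x (lo i)) (x (hi i)) => [] [] /=; ring.
Qed.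

Lemma lowerZ (c : rat) f : lower (c *: f) = c *: lower f.
Proof.
apply/ffunP => x; rewrite !ffunE scaler_sumr; apply: eq_bigr => i _.
by rewrite ffunE scalerAr.
Qed.

Lemma raise0 : raise 0 = 0.
Proof. by apply/ffunP => x; rewrite !ffunE big1 // => i _; rewrite ffunE mulr0. Qed.

Lemma lower_supp m k f :
    (forall x, f x != 0 -> bit_weight x = m /\ bit_height x = k) ->
  forall x, lower f x != 0 -> bit_weight x = m /\ (bit_height x).+1 = k.
Proof.
move=> supp_f x; rewrite ffunE => nz.
have /existsP[i] : [exists i, can_up i x && (f (flip i x) != 0)].
  apply: contraNT nz; rewrite negb_exists => /forallP no_i.
  rewrite big1 // => i _; have := no_i i; rewrite negb_and negbK.
  by case/orP=> [/negPf -> | /eqP ->]; rewrite ?mulr0 ?mul0r.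
by case/andP=> up_i /supp_f[]; rewrite weight_flip height_flip_up.
Qed.

(** This is raising_inj for raise and lower: lower^j f lives at height k - j, so
    the commutator acts on it by 2(k-j) - nm < 0, and it vanishes for j > k. *)
Lemma raise_inj m k f :
    (2 * k < m * n)%N ->
    (forall x, f x != 0 -> bit_weight x = m /\ bit_height x = k) ->
  raise f = 0 -> f = 0.
Proof.
move=> lt_k supp_f.
have supp (j : nat) x : iter j lower f x != 0 ->
    bit_weight x = m /\ (bit_height x + j)%N = k.
  elim: j x => [|j IHj] x; first by rewrite addn0; apply: supp_f.
  have supp_j z : iter j lower f z != 0 ->
      bit_weight z = m /\ bit_height z = (k - j)%N.
    by move/IHj => [-> <-]; rewrite addnK.
  by rewrite iterS => /(lower_supp supp_j)[-> ht_x]; split=> //; lia.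
have iter_eq0 (j : nat) : (k < j)%N -> iter j lower f = 0.
  move=> lt_kj; apply/ffunP => x; rewrite [RHS]ffunE; apply/eqP.
  by apply: contraTT lt_kj => /supp[_]; lia.
(* For j > k the vector is zero, so any negative value will do. *)
pose h (j : nat) : rat := if (j <= k)%N then (2 * (k - j))%:R - (n * m)%:R else -1.
apply: (@raising_inj _ _ raise lower h f k.+1); last exact: iter_eq0.
- exact: raise0.
- exact: lowerZ.
- move=> j; apply/ffunP => x; rewrite raise_lower_comm [RHS]ffunE.
  congr (_ + _); rewrite [RHS]ffunE.
  have [->|nz] := eqVneq (iter j lower f x) 0.
    by rewrite mulr0 scaler0.
  have [-> ht_x] := supp j x nz.
  by rewrite /h -ht_x leq_addl addnK.
- move=> j; rewrite /h; case: leqP => // _.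
  by rewrite subr_lt0 ltr_nat; nia.
Qed.

End Raising.

(** Unimodality below the middle: raise embeds functions on one level into
    functions on the next one. *)
Lemma leq_card_bit_level n m k : (2 * k < m * n.-1)%N ->
  (#|bit_level n m k| <= #|bit_level n m k.+1|)%N.
Proof.
case: n => [|n]; first by rewrite muln0.
rewrite [n.+1.-1]/= => lt_k.
pose M (s t : {ffun 'I_n.+1 -> bool}) : rat :=
  \sum_i (can_down i t && (s == flip i t))%:R.
apply: (@leq_card_inj_kernel _ _ _ _ M) => f f_out fM0.
pose F : {ffun {ffun 'I_n.+1 -> bool} -> rat^o} := finfun f.
have raiseE t : raise F t = \sum_s f s * M s t.
  rewrite ffunE /M; under [RHS]eq_bigr => s _ do rewrite mulr_sumr.
  rewrite exchange_big /=; apply: eq_bigr => i _; rewrite ffunE.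
  rewrite (bigD1 (flip i t)) //= eqxx andbT big1 ?addr0 1?mulrC //.
  by move=> s /negPf ->; rewrite andbF mulr0.
have supp_F t : F t != 0 -> bit_weight t = m /\ bit_height t = k.
  rewrite ffunE => nz; have: t \in bit_level n.+1 m k.
    by apply: contraNT nz => /f_out ->.
  by rewrite inE => /andP[/eqP -> /eqP ->].
suff F0 : F = 0 by move=> t; rewrite -[f t]ffunE -/F F0 ffunE.
apply: (raise_inj lt_k supp_F); apply/ffunP => t; rewrite [RHS]ffunE.
have [tB|tB] := boolP (t \in bit_level n.+1 m k.+1).
  by rewrite raiseE fM0.
rewrite ffunE big1 // => i _; have [down_t|] := boolP (can_down i t); last first.
  by rewrite mul0r.
rewrite mul1r; apply/eqP; apply: contraNT tB => /supp_F[].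
by rewrite weight_flip inE (height_flip_down down_t) => -> ->; rewrite !eqxx.
Qed.

(** * Gaussian polynomials *)

(** This is q^(m(m-1)/2) times the q-binomial coefficient of n over m (see
    poch_gauss): a bit vector of weight m is an m-subset of {0, ..., n-1}. The
    power of q is kept because it makes the coefficients plain cardinals, and
    the centre of symmetry m(n-1)/2. *)
Definition gauss n m : {poly int} :=
  \sum_(x : {ffun 'I_n -> bool} | bit_weight x == m) 'X^(bit_height x).

Definition poch n : {poly int} := \prod_(i < n) (1 - 'X^(i.+1)).

Lemma coef_gauss n m k : (gauss n m)`_k = #|bit_level n m k|%:R.
Proof.
rewrite coef_sum -sum1_card natr_sum big_mkcond [RHS]big_mkcond.
apply: eq_bigr => x _; rewrite inE coefXn eq_sym.
by case: eqP => //= _; rewrite eq_sym; case: eqP.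
Qed.

Lemma coef_gauss_ge0 n m k : 0 <= (gauss n m)`_k.
Proof. by rewrite coef_gauss ler0n. Qed.

Lemma bit_height_rev n (x : {ffun 'I_n -> bool}) :
  (bit_height x + bit_height [ffun i => x (rev_ord i)]
    = bit_weight x * n.-1)%N.
Proof.
rewrite {2}/bit_height (reindex_inj rev_ord_inj) /= -big_split /= big_distrl.
apply: eq_bigr => i _; rewrite ffunE rev_ordK /=.
by have := ltn_ord i; case: (x i); lia.
Qed.

Lemma gauss_sym n m k : (k <= m * n.-1)%N ->
  (gauss n m)`_k = (gauss n m)`_(m * n.-1 - k).
Proof.
move=> le_k; rewrite !coef_gauss; congr _%:R.
pose r (x : {ffun 'I_n -> bool}) := [ffun i => x (rev_ord i)].
have rK : involutive r by move=> x; apply/ffunP => i; rewrite !ffunE rev_ordK.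
rewrite -(card_preimset _ (inv_inj rK)); apply: eq_card => x; rewrite !inE.
have -> : bit_weight (r x) = bit_weight x.
  rewrite /bit_weight [RHS](reindex_inj rev_ord_inj).
  by apply: eq_bigr => i _; rewrite ffunE.
case: eqP => //= wt_x; have := bit_height_rev x; rewrite -/(r x) wt_x.
by lia.
Qed.

Lemma gauss_large n m k : (m * n.-1 < k)%N -> (gauss n m)`_k = 0.
Proof.
move=> lt_k; rewrite coef_gauss eq_card0 // => x; rewrite !inE.
by apply/negbTE/andP => -[/eqP wt_x /eqP ht_x]; have := bit_height_rev x; lia.
Qed.

Lemma gauss_incr n m k : (2 * k < m * n.-1)%N ->
  (gauss n m)`_k <= (gauss n m)`_k.+1.
Proof. by move=> lt_k; rewrite !coef_gauss ler_nat leq_card_bit_level. Qed.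

(** The q-binomial theorem. *)
Lemma gauss_coefE n m :
  gauss n m = (\prod_(i < n) (1 + ('X^i)%:P * 'X) : {poly {poly int}})`_m.
Proof.
pose F (i : 'I_n) (b : bool) : {poly {poly int}} := (('X^i)%:P * 'X) ^+ b.
under eq_bigr => i _.
  have -> : 1 + ('X^i)%:P * 'X = \sum_b F i b.
    by rewrite big_bool /F expr0 expr1 addrC.
  over.
rewrite bigA_distr_bigA coef_sum /gauss big_mkcond; apply: eq_bigr => x _.
have -> : \prod_i F i (x i) = ('X^(bit_height x))%:P * 'X^(bit_weight x).
  rewrite /bit_height /bit_weight -!prodrXr rmorph_prod -big_split.
  apply: eq_bigr => i _.
  by rewrite /F exprMn -rmorphXn -exprM.
by rewrite coefCM coefXn eq_sym; case: eqP; rewrite ?mulr1 ?mulr0.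
Qed.

Lemma gaussS n m : gauss n.+1 m.+1 = gauss n m.+1 + 'X^n * gauss n m.
Proof.
rewrite !gauss_coefE big_ord_recr /= mulrDr mulr1 coefD; congr (_ + _).
by rewrite mulrCA coefCM coefMX.
Qed.

Lemma gauss0 n : gauss n 0 = 1.
Proof.
elim: n => [|n]; first by rewrite gauss_coefE big_ord0 coef1.
rewrite !gauss_coefE big_ord_recr /= mulrDr mulr1 coefD => ->.
by rewrite mulrCA coefCM coefMX mulr0 addr0.
Qed.

Lemma gauss_small n m : (n < m)%N -> gauss n m = 0.
Proof.
elim: n m => [|n IHn] [|m] //.
  by rewrite gauss_coefE big_ord0 coef1.
by move=> lt_nm; rewrite gaussS !IHn ?mulr0 ?addr0 // ltnW.
Qed.

Lemma pochS n : poch n.+1 = poch n * (1 - 'X^(n.+1)).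
Proof. by rewrite /poch big_ord_recr. Qed.

(** The factorial formula for the q-binomial coefficient with n = m + k, cleared
    of denominators; the induction is the q-Pascal rule gaussS. *)
Lemma poch_gauss m k :
  poch m * poch k * gauss (m + k) m = 'X^'C(m, 2) * poch (m + k).
Proof.
have [s] := ubnP (m + k); elim: s m k => // s IHs [|m] k lt_s.
  by rewrite gauss0 /poch big_ord0 bin0n expr0 add0n !mul1r mulr1.
rewrite addSn gaussS binS bin1 mulrDr.
case: k lt_s => [|k] lt_s.
  rewrite addn0 gauss_small // mulr0 add0r !pochS.
  have := IHs m 0%N; rewrite addn0 => IH.
  have {}IH := IH ltac:(lia).
  transitivity (poch m * poch 0 * gauss m m * ('X^m * (1 - 'X^(m.+1)))).
    by ring.
  by rewrite IH exprD; ring.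
have IH1 := IHs m k.+1 ltac:(lia).
have IH2 := IHs m.+1 k ltac:(lia).
rewrite binS bin1 exprD in IH2.
rewrite addSnnS in IH2.
transitivity (poch m.+1 * poch k * gauss (m + k.+1) m.+1 * (1 - 'X^(k.+1))
   + poch m * poch k.+1 * gauss (m + k.+1) m * ('X^(m + k.+1) * (1 - 'X^(m.+1)))).
  by rewrite (pochS k) (pochS m); ring.
rewrite IH1 IH2 (pochS (m + k.+1)) -addSn !exprD; ring.
Qed.

(** * Quotients of symmetric unimodal polynomials *)

(** Put F = (1 - X^b) p. Symmetry and unimodality of p around D/2 say that
    F`_j >= 0 for 2j <= D+b and F`_j <= 0 for 2j >= D+b. As
    Q`_j = F`_j + Q`_(j-a), the coefficients of Q up to (D+b)/2 are nonnegative
    by upward induction; as Q`_j = Q`_(j+a) - F`_(j+a), those above are by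
    downward induction from the degree of Q. *)
Lemma unimodal_quotient_ge0 (R : realDomainType) (p Q : {poly R}) (D a b : nat) :
    (0 < a)%N ->
    (forall k, 0 <= p`_k) ->
    (forall k, (k <= D)%N -> p`_k = p`_(D - k)) ->
    (forall k, (D < k)%N -> p`_k = 0) ->
    (forall k, (2 * k < D)%N -> p`_k <= p`_k.+1) ->
    (1 - 'X^b) * p = (1 - 'X^a) * Q ->
  forall j, 0 <= Q`_j.
Proof.
move=> a_gt0 p_ge0 p_sym p_large p_incr eq_pQ.
have p_le_lower i j : (i <= j)%N -> (2 * j <= D)%N -> p`_i <= p`_j.
  elim: j => [|j IHj]; first by rewrite leqn0 => /eqP ->.
  rewrite leq_eqVlt => /predU1P[-> //|lt_ij] le_j.
  by apply: le_trans (IHj _ _) (p_incr _ _); lia.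
have p_le i j : (i <= j)%N -> (i + j <= D)%N -> p`_i <= p`_j.
  move=> le_ij le_D; have [le_j|lt_j] := leqP (2 * j) D; first exact: p_le_lower.
  by rewrite (p_sym j) ?p_le_lower //; lia.
have p_ge i j : (i <= j)%N -> (D <= i + j)%N -> p`_j <= p`_i.
  move=> le_ij le_D; have [lt_j|le_j] := ltnP D j; first by rewrite p_large.
  by rewrite (p_sym j) // p_le //; lia.
pose F := (1 - 'X^b) * p.
have coefF j : F`_j = p`_j - (if (j < b)%N then 0 else p`_(j - b)).
  by rewrite /F mulrBl mul1r coefB coefXnM.
have F_ge0 j : (2 * j <= D + b)%N -> 0 <= F`_j.
  move=> le_j; rewrite coefF subr_ge0; case: ltnP => // le_bj.
  by apply: p_le; lia.
have F_le0 j : (D + b <= 2 * j)%N -> F`_j <= 0.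
  move=> le_j; rewrite coefF subr_le0; case: ltnP => [lt_jb|le_bj].
    by rewrite p_large //; lia.
  by apply: p_ge; lia.
have coefQ j : F`_j = Q`_j - (if (j < a)%N then 0 else Q`_(j - a)).
  by rewrite /F eq_pQ mulrBl mul1r coefB coefXnM.
have Q_low j : (2 * j <= D + b)%N -> 0 <= Q`_j.
  have [s] := ubnP j; elim: s j => // s IHs j lt_s le_j.
  have := F_ge0 _ le_j; rewrite coefQ subr_ge0; apply: le_trans.
  by case: ltnP => // le_aj; apply: IHs; lia.
have Q_high j : (D + b <= 2 * j)%N -> 0 <= Q`_j.
  have [s] := ubnP (size Q - j); elim: s j => // s IHs j lt_s le_j.
  have [le_Qj|lt_jQ] := leqP (size Q) j; first by rewrite nth_default.
  have: F`_(j + a) <= 0 by apply: F_le0; lia.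
  rewrite coefQ ltnNge leq_addl /= addnK subr_le0; apply: le_trans.
  by apply: IHs; lia.
by move=> j; case: (leqP (2 * j) (D + b)) => [/Q_low|/ltnW/Q_high].
Qed.

(** * Divisibility by 1 - X^a *)

Notation toC := (map_poly (intr : int -> algC)).

(** Euclidean division by the monic X^a - 1 is possible over the integers, and
    the remainder has degree less than a but vanishes at the a distinct a-th
    roots of unity. *)
Lemma dvdp_one_subXn (a : nat) (F : {poly int}) : (0 < a)%N ->
    (forall z : algC, z ^+ a = 1 -> root (toC F) z) ->
  exists Q, F = (1 - 'X^a) * Q.
Proof.
move=> a_gt0 rootF; pose d : {poly int} := 'X^a - 1.
have d_mon : d \is monic by rewrite /d monicXnsubC.
have sz_d : size d = a.+1 by rewrite /d size_XnsubC.
pose r := Pdiv.Ring.rmodp F d; pose Q := Pdiv.Ring.rdivp F d.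
have F_eq : F = Q * d + r by exact: Pdiv.RingMonic.rdivp_eq.
suff r0 : r = 0 by exists (- Q); rewrite {1}F_eq r0 /d; ring.
have sz_r : (size r < a.+1)%N by rewrite -sz_d Pdiv.Ring.ltn_rmodp monic_neq0.
have [w w_prim] := C_prim_root_exists a_gt0.
pose rs := [seq w ^+ val i | i : 'I_a].
have rs_uniq : uniq rs.
  rewrite map_inj_uniq ?enum_uniq // => i j /eqP.
  rewrite (eq_prim_root_expr w_prim) !modn_small ?ltn_ord // => /eqP.
  exact: val_inj.
have root_r : all (root (toC r)) rs.
  apply/allP => _ /mapP[i _ ->].
  have wi1 : (w ^+ i) ^+ a = 1 by rewrite exprAC (prim_expr_order w_prim) expr1n.
  have := rootF _ wi1; rewrite {1}F_eq rmorphD rmorphM /d rmorphB.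
  rewrite /= map_polyXn rmorph1.
  by rewrite /root !hornerE wi1 subrr mulr0 add0r.
apply/eqP; apply: contraTT sz_r => r_neq0.
have pr_neq0 : toC r != 0.
  by rewrite map_poly_eq0_id0 // intr_eq0 lead_coef_eq0.
have := max_poly_roots pr_neq0 root_r rs_uniq.
rewrite size_image card_ord size_map_poly_id0 ?intr_eq0 ?lead_coef_eq0 //.
by rewrite -leqNgt.
Qed.

Lemma one_subXn_neq0 (R : nzRingType) n : 1 - 'X^(n.+1) != 0 :> {poly R}.
Proof. by rewrite -oppr_eq0 opprB monic_neq0 // monicXnsubC. Qed.

(** The roots of 1 - X^(n+1) are simple because its derivative only vanishes
    at 0. *)
Lemma mup_one_subXn (d n : nat) (z : algC) : d.-primitive_root z ->
  mup z (1 - 'X^(n.+1)) = (d %| n.+1)%N.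
Proof.
move=> z_prim; have p_neq0 := one_subXn_neq0 algC n.
have root_p : root (1 - 'X^(n.+1) : {poly algC}) z = (d %| n.+1)%N.
  rewrite /root !hornerE subr_eq0 eq_sym.
  by rewrite -(prim_order_dvd z_prim).
have [dvd_n|ndvd_n] := boolP (d %| n.+1)%N; last first.
  by rewrite mupNroot // root_p.
apply/eqP; rewrite eqn_leq mup_geq // expr1 dvdp_XsubCl root_p dvd_n andbT.
rewrite mup_leq //; apply/negP => /dvdpP[g def_p].
have := congr1 (fun p => p^`().[z]) def_p.
rewrite expr2 derivB derivXn -polyC1 derivC !derivM derivXsubC.
rewrite !(hornerE, subrr, hornerMn) /= => /eqP.
rewrite !mulr0 mul0r addr0 oppr_eq0 mulrn_eq0 expf_eq0 (prim_root_eq0 z_prim).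
by rewrite /= (gtn_eqF (prim_order_gt0 z_prim)) andbF.
Qed.

Lemma poch_neq0 n : poch n != 0.
Proof. by apply/prodf_neq0 => i _; apply: one_subXn_neq0. Qed.

Lemma horner_poch0 n : (poch n).[0] = 1.
Proof.
by rewrite horner_prod big1 // => i _; rewrite !hornerE expr0n subr0.
Qed.

Lemma map_poch n : toC (poch n) = \prod_(i < n) (1 - 'X^(i.+1)).
Proof.
rewrite rmorph_prod; apply: eq_bigr => i _.
by rewrite rmorphB /= map_polyXn rmorph1.
Qed.

Lemma map_poch_neq0 n : toC (poch n) != 0.
Proof. by rewrite map_poch; apply/prodf_neq0 => i _; apply: one_subXn_neq0. Qed.

Lemma mup_poch d n (z : algC) : d.-primitive_root z ->
  mup z (toC (poch n)) = (n %/ d)%N.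
Proof.
move=> z_prim; have d_gt0 := prim_order_gt0 z_prim.
elim: n => [|n IHn].
  by rewrite map_poch big_ord0 div0n mupNroot // root1.
rewrite pochS rmorphM /= rmorphB /= map_polyXn rmorph1.
rewrite mupM ?map_poch_neq0 ?one_subXn_neq0 // IHn (mup_one_subXn _ z_prim).
by rewrite divnS // addnC.
Qed.

(** By mup_poch the multiplicity of z is (m+k)/d - m/d - k/d (integer
    quotients), the carry of m + k in base d: it is 0 or 1 and only depends on
    the residues of m and k modulo d. *)
Lemma root_gauss d m k (z : algC) : d.-primitive_root z ->
  root (toC (gauss (m + k) m)) z = (d <= m %% d + k %% d)%N.
Proof.
move=> z_prim; have d_gt0 := prim_order_gt0 z_prim.
have z_neq0 : z != 0 by rewrite (prim_root_eq0 z_prim) -lt0n.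
have eqP := congr1 toC (poch_gauss m k).
rewrite !rmorphM /= map_polyXn in eqP.
have X_neq0 : 'X^'C(m, 2) != 0 :> {poly algC} by rewrite monic_neq0 ?monicXn.
have g_neq0 : toC (gauss (m + k) m) != 0.
  by apply: contra_eq_neq eqP => ->; rewrite mulr0 eq_sym mulf_neq0 ?map_poch_neq0.
have := congr1 (mup z) eqP.
rewrite !mupM ?mulf_neq0 ?map_poch_neq0 // !(mup_poch _ z_prim).
rewrite [mup z 'X^_]mupNroot; last by rewrite /root hornerXn expf_neq0.
rewrite divnD // add0n => /addnI mup_g.
by rewrite -dvdp_XsubCl XsubC_dvd // mup_g lt0b.
Qed.

(** An a-th root of unity z has an order d dividing a, so whether z is a root of
    the left-hand side is determined by m and k modulo a. *)
Lemma gauss_dvd_periodic (a b m k m' k' : nat) (Q : {poly int}) :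
    (0 < a)%N -> m = m' %[mod a] -> k = k' %[mod a] ->
    (1 - 'X^b) * gauss (m + k) m = (1 - 'X^a) * Q ->
  exists Q', (1 - 'X^b) * gauss (m' + k') m' = (1 - 'X^a) * Q'.
Proof.
move=> a_gt0 eq_m eq_k def_Q; apply: dvdp_one_subXn => // z za1.
have [d z_prim d_dvd] := prim_order_exists a_gt0 za1.
have eq_mod u v : u = v %[mod a] -> (u %% d = v %% d)%N.
  by move=> e; rewrite -(modn_dvdm u d_dvd) e modn_dvdm.
have rootE u v : root (toC ((1 - 'X^b) * gauss (u + v) u)) z
    = (z ^+ b == 1) || (d <= u %% d + v %% d)%N.
  rewrite rmorphM rootM (root_gauss _ _ z_prim) rmorphB /= map_polyXn rmorph1.
  by rewrite /root !hornerE subr_eq0 eq_sym.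
rewrite rootE -(eq_mod _ _ eq_m) -(eq_mod _ _ eq_k) -rootE def_Q.
rewrite rmorphM rmorphB /= map_polyXn rmorph1.
by rewrite /root !hornerE za1 subrr mul0r.
Qed.

(** * Positivity and periodicity *)

Lemma Xn_factor (R : idomainType) (p g r : {poly R}) c :
  p`_0 = 1 -> p * g = 'X^c * r -> exists h, g = 'X^c * h.
Proof.
move=> p0; elim: c r => [|c IHc] r eq_pg; first by exists g; rewrite expr0 mul1r.
have [h def_g] := IHc ('X * r) ltac:(by rewrite eq_pg exprSr mulrA).
have /(congr1 (coefp 0)) : p * h = 'X * r.
  have X_neq0 : 'X^c != 0 :> {poly R} by rewrite monic_neq0 ?monicXn.
  by apply: (mulfI X_neq0); rewrite mulrCA -def_g eq_pg exprSr mulrA.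
rewrite /= coef0M p0 mul1r coefXM /= => h0.
have /factor_theorem[h' def_h] : root h 0 by rewrite /root horner_coef0 h0.
by exists h'; rewrite def_g def_h subr0 exprSr -mulrA (mulrC h').
Qed.

Lemma qpochE n : qpoch n = tofrac (poch n).
Proof.
rewrite /qpoch /poch big_add1 big_mkord rmorph_prod; apply: eq_bigr => i _.
by rewrite rmorphB /= rmorph1 rmorphXn.
Qed.

Lemma A_eq_tofrac (a b m k : nat) (p : {poly int}) : (0 < a)%N ->
  A b a (m + k) m = tofrac p <->
  (1 - 'X^b) * gauss (m + k) m = (1 - 'X^a) * ('X^'C(m, 2) * p).
Proof.
move=> a_gt0.
have a_neq0 : 1 - 'X^a != 0 :> {poly int}.
  by rewrite -(prednK a_gt0) one_subXn_neq0.
have X_neq0 : 'X^'C(m, 2) != 0 :> {poly int} by rewrite monic_neq0 ?monicXn.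
have tofracX c : 1 - q ^+ c = tofrac (1 - 'X^c).
  by rewrite rmorphB rmorph1 rmorphXn.
rewrite /A /qbinom leq_addr addKn !qpochE !tofracX mulf_div -!rmorphM.
have den_neq0 : (1 - 'X^a) * (poch m * poch k) != 0 by rewrite !mulf_neq0 ?poch_neq0.
have den_F : tofrac ((1 - 'X^a) * (poch m * poch k)) != 0 by rewrite tofrac_eq0.
have gaussP := poch_gauss m k.
split=> [/(canRL (mulfVK den_F)) |] => [/eqP|eq_g].
  rewrite -rmorphM tofrac_eq => /eqP eq_p.
  apply: (mulfI (mulf_neq0 (poch_neq0 m) (poch_neq0 k))).
  rewrite mulrCA gaussP mulrCA eq_p; ring.
apply: (canLR (mulfK den_F)); apply/eqP; rewrite -rmorphM tofrac_eq; apply/eqP.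
apply: (mulfI X_neq0); rewrite mulrCA -gaussP mulrCA eq_g; ring.
Qed.

(** Being a polynomial passes to the second quotient by periodicity, and a
    quotient that is a polynomial is nonnegative by unimodality. *)
Lemma in_N0q_periodic (a b m k m' k' : nat) :
    (0 < a)%N -> m = m' %[mod a] -> k = k' %[mod a] ->
  in_N0q (A b a (m + k) m) -> in_N0q (A b a (m' + k') m').
Proof.
move=> a_gt0 eq_m eq_k [p _ /(A_eq_tofrac _ _ _ _ a_gt0)].
move=> /(gauss_dvd_periodic a_gt0 eq_m eq_k)[Q def_Q].
have Q_ge0 := unimodal_quotient_ge0 a_gt0 (@coef_gauss_ge0 _ _) (@gauss_sym _ _)
  (@gauss_large _ _) (@gauss_incr _ _) def_Q.
(* Remove from Q the power of X by which gauss differs from the q-binomial. *)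
have [h def_h] : exists h, Q = 'X^'C(m', 2) * h.
  apply: (@Xn_factor _ ((1 - 'X^a) * (poch m' * poch k')) _
            ((1 - 'X^b) * poch (m' + k'))).
    rewrite -horner_coef0 !hornerE !horner_poch0 expr0n (gtn_eqF a_gt0).
    by rewrite !(subr0, mulr1).
  have gaussP := poch_gauss m' k'.
  rewrite mulrAC -def_Q [RHS]mulrCA -gaussP; ring.
exists h; last by apply/A_eq_tofrac; rewrite -?def_h.
by apply/polyOverP => j; have := Q_ge0 (j + 'C(m', 2))%N;
  rewrite def_h coefXnM ltnNge leq_addl /= addnK.
Qed.

Unset Implicit Arguments.

Theorem corollary1 (a b m n : nat) (a_gt0 : (0 < a)%N)
    (le_ba : (b <= a)%N) (le_mn : (m <= n)%N) :
  in_N0q (A b a n m) <->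
  (forall k l : int,
     0 <= m%:Z + k * a%:Z -> m%:Z + k * a%:Z <= n%:Z + l * a%:Z ->
     in_N0q (A b a (absz (n%:Z + l * a%:Z)%R) (absz (m%:Z + k * a%:Z)%R))).
Proof.
split=> [A_N0q k l | A_N0q]; last first.
  by have := A_N0q 0 0; rewrite !mul0r !addr0; apply; lia.
case def_m: (m%:Z + k * a%:Z) => [m'|//] _.
case def_n: (n%:Z + l * a%:Z) => [n'|]; last by lia.
rewrite lez_nat => le_mn' /=.
rewrite -(subnKC le_mn) in A_N0q; rewrite -(subnKC le_mn').
apply: in_N0q_periodic A_N0q => //.
  apply/eqP; rewrite -eqz_nat -!modz_nat -def_m addrC modzMDl; exact: eqxx.
have eq_k : ((n' - m')%N : int) = (l - k) * a%:Z + (n - m)%N.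
  by rewrite -!subzn // -def_m -def_n; ring.
by apply/eqP; rewrite -eqz_nat -!modz_nat eq_k modzMDl; exact: eqxx.
Qed.
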